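(* Let $(A,\dashv_A,\vdash_A)$ be a diassociative algebra and let $r=\sum_i u_i\otimes v_i\in A\otimes A$ be a symmetric solution of the diassociative Yang-Baxter equation (DYBE) in $(A,\dashv_A,\vdash_A)$. Define linear maps $\Delta_{\dashv_A},\Delta_{\vdash_A}:A\to A\otimes A$ by $$\Delta_{\dashv_A}(x):=(\mathrm{id}\otimes L_{\bullet_A}(x)-R_{\vdash_A}(x)\otimes\mathrm{id})\,r,\qquad \Delta_{\vdash_A}(x):=(\mathrm{id}\otimes L_{\dashv_A}(x)+R_{\bullet_A}(x)\otimes\mathrm{id})(-r),\qquad x\in A.$$ Then $(A,\dashv_A,\vdash_A,\Delta_{\dashv_A},\Delta_{\vdash_A})$ is a diassociative bialgebra.
   Context: All vector spaces are finite-dimensional over a field $\mathbf{k}$ of characteristic $0$. A diassociative algebra is a triple $(A,\dashv_A,\vdash_A)$ consisting of a vector space $A$ and two bilinear operations such that for all $x,y,z\in A$ (subscripts omitted): $(x\dashv y)\dashv z=x\dashv(y\dashv z)=x\dashv(y\vdash z)$; $(x\vdash y)\dashv z=x\vdash(y\dashv z)$; $(x\vdash y)\vdash z=(x\dashv y)\vdash z=x\vdash(y\vdash z)$. Put $x\bullet_A y:=x\vdash_A y-x\dashv_A y$. For a bilinear operation $\diamond$, $L_\diamond(x)y=x\diamond y$ and $R_\diamond(y)x=x\diamond y$. $\sigma(u\otimes v)=v\otimes u$; $r$ is symmetric if $\sigma(r)=r$. The element $r=\sum_i u_i\otimes v_i$ is a solution of the DYBE in $(A,\dashv_A,\vdash_A)$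 if in $A\otimes A\otimes A$ $$D(r):=\sum_{i,j}\big(u_i\vdash_A u_j\otimes v_i\otimes v_j-u_i\otimes u_j\otimes v_i\dashv_A v_j-u_i\otimes u_j\bullet_A v_i\otimes v_j\big)=0 .$$ A diassociative coalgebra is a triple $(A,\Delta_{\dashv},\Delta_{\vdash})$ with linear maps $\Delta_{\dashv},\Delta_{\vdash}:A\to A\otimes A$ such that $(\mathrm{id}\otimes\Delta_{\dashv})\Delta_{\dashv}=(\mathrm{id}\otimes\Delta_{\vdash})\Delta_{\dashv}=(\Delta_{\dashv}\otimes\mathrm{id})\Delta_{\dashv}$; $(\Delta_{\vdash}\otimes\mathrm{id})\Delta_{\dashv}=(\mathrm{id}\otimes\Delta_{\dashv})\Delta_{\vdash}$; $(\Delta_{\dashv}\otimes\mathrm{id})\Delta_{\vdash}=(\Delta_{\vdash}\otimes\mathrm{id})\Delta_{\vdash}=(\mathrm{id}\otimes\Delta_{\vdash})\Delta_{\vdash}$. A diassociative bialgebra is $(A,\dashv,\vdash,\Delta_{\dashv},\Delta_{\vdash})$ such that $(A,\dashv,\vdash)$ is a diassociative algebra, $(A,\Delta_{\dashv},\Delta_{\vdash})$ is a diassociative coalgebra and, with $\Delta_{\bullet}:=\Delta_{\vdash}-\Delta_{\dashv}$, for all $x,y\in A$: (1) $\Delta_{\vdash}(x\dashv y)=(\mathrm{id}\otimes L_{\dashv}(x))\Delta_{\vdash}(y)-(R_{\bullet}(y)\otimes\mathrm{id})\Delta_{\vdash}(x)=(\mathrm{id}\otimes L_{\dashv}(x))\Delta_{\bullet}(y)+(R_{\dashv}(y)\otimes\mathrm{id})\Delta_{\vdash}(x)$;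 (2) $\sigma((L_{\vdash}(y)\otimes\mathrm{id})\Delta_{\vdash}(x))-(L_{\dashv}(x)\otimes\mathrm{id})\Delta_{\bullet}(y)=(L_{\dashv}(x)\otimes\mathrm{id})\Delta_{\dashv}(y)+\sigma((L_{\bullet}(y)\otimes\mathrm{id})\Delta_{\vdash}(x))=\sigma((\mathrm{id}\otimes R_{\dashv}(y))\Delta_{\vdash}(x))+(\mathrm{id}\otimes R_{\bullet}(x))\Delta_{\bullet}(y)$; (3) $\sigma((\mathrm{id}\otimes R_{\vdash}(y))\Delta_{\vdash}(x))-(\mathrm{id}\otimes R_{\bullet}(x))\Delta_{\dashv}(y)=(\mathrm{id}\otimes R_{\dashv}(x))\Delta_{\dashv}(y)+\sigma((\mathrm{id}\otimes R_{\vdash}(y))\Delta_{\bullet}(x))=(L_{\vdash}(x)\otimes\mathrm{id})\Delta_{\dashv}(y)+\sigma((L_{\bullet}(y)\otimes\mathrm{id})\Delta_{\bullet}(x))$; (4) $\Delta_{\dashv}(x\vdash y)=(\mathrm{id}\otimes L_{\vdash}(x))\Delta_{\dashv}(y)-(R_{\vdash}(y)\otimes\mathrm{id})\Delta_{\bullet}(x)=(\mathrm{id}\otimes L_{\bullet}(x))\Delta_{\dashv}(y)+(R_{\vdash}(y)\otimes\mathrm{id})\Delta_{\dashv}(x)$; (5) $\Delta_{\dashv}(x\dashv y)=(R_{\dashv}(y)\otimes\mathrm{id})\Delta_{\dashv}(x)-(\mathrm{id}\otimes L_{\bullet}(x))\Delta_{\bullet}(y)$; (6) $\Delta_{\vdash}(x\vdash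 y)=(\mathrm{id}\otimes L_{\vdash}(x))\Delta_{\vdash}(y)-(R_{\bullet}(y)\otimes\mathrm{id})\Delta_{\bullet}(x)$. *)

(* Defs.v *)
From HB Require Import structures.
From mathcomp Require Import all_boot all_order all_algebra.

Set Implicit Arguments.
Unset Strict Implicit.
Unset Printing Implicit Defensive.

Import GRing.Theory.
Local Open Scope ring_scope.

(* The tensor product of two finite-dimensional vector spaces, represented by
   coordinates: t i j is the coefficient of t on e_i ⊗ f_j, where (e_i) and
   (f_j) are the library's bases of U and V.  Lemmas tlift_tens and
   tlift_unique below are the universal property. *)
Definition tensor (K : fieldType) (U V : vectType K) : Type :=
  'M[K]_(\dim {:U}, \dim {:V}).

Arguments tensor {K} (U V)%_type.

HB.instance Definition _ (K : fieldType) (U V : vectType K) :=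
  Vector.on (tensor U V).

Notation "U ⊗ V" := (tensor U V) (at level 40, left associativity) : type_scope.

Definition tens (K : fieldType) (U V : vectType K) (u : U) (v : V) : U ⊗ V :=
  \matrix_(i, j) (coord (vbasis {:U}) i u * coord (vbasis {:V}) j v).

Notation "u ⊗ v" := (tens u v) (at level 40, left associativity) : ring_scope.

(* The linear map on U ⊗ V induced by a bilinear map b. *)
Definition tlift (K : fieldType) (U V W : vectType K) (b : U -> V -> W)
    (t : U ⊗ V) : W :=
  \sum_i \sum_j (t : 'M__) i j *: b (vbasis {:U})`_i (vbasis {:V})`_j.

Section TensorTheory.
Variable K : fieldType.
Implicit Types U V W : vectType K.

Lemma coord_fullv U (u : U) :
  u = \sum_i coord (vbasis {:U}) i u *: (vbasis {:U})`_i.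
Proof. exact/coord_vbasis/memvf. Qed.

Fact tens_is_bilinear U V :
  bilinear_for *:%R *:%R (@tens K U V).
Proof.
split=> [v|u] a x y; apply/matrixP=> i j; rewrite !mxE linearP /=.
  by rewrite mulrDl mulrA.
by rewrite mulrDr mulrCA.
Qed.

HB.instance Definition _ U V :=
  bilinear_isBilinear.Build K U V (U ⊗ V)%type *:%R *:%R (@tens K U V)
    (@tens_is_bilinear U V).

Fact tlift_is_linear U V W (b : U -> V -> W) : linear (tlift b).
Proof.
move=> a s t; rewrite /tlift scaler_sumr -big_split; apply: eq_bigr => i _ /=.
rewrite scaler_sumr -big_split; apply: eq_bigr => j _ /=.
by rewrite !mxE scalerDl scalerA.
Qed.

HB.instance Definition _ U V W (b : U -> V -> W) :=
  GRing.isLinear.Build K (U ⊗ V)%type W _ (tlift b) (tlift_is_linear b).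

Lemma tlift_comb U V W (a : K) (b b1 b2 : U -> V -> W) t :
  (forall u v, b u v = a *: b1 u v + b2 u v) ->
  tlift b t = a *: tlift b1 t + tlift b2 t.
Proof.
move=> bE; rewrite /tlift scaler_sumr -big_split; apply: eq_bigr => i _ /=.
rewrite scaler_sumr -big_split; apply: eq_bigr => j _ /=.
by rewrite bE scalerDr !scalerA mulrC.
Qed.

Lemma tlift_tens U V W (b : U -> V -> W) u v :
  bilinear_for *:%R *:%R b -> tlift b (u ⊗ v) = b u v.
Proof.
move=> bP; have [b' ->] : exists b' : {bilinear U -> V -> W}, b = b'.
  pose B := bilinear_isBilinear.Build K U V W *:%R *:%R b bP.
  by exists (HB.pack b B : {bilinear U -> V -> W}).
rewrite {2}(coord_fullv u) {2}(coord_fullv v) linear_sumlz /tlift.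
apply: eq_bigr => i _; rewrite linear_sumr; apply: eq_bigr => j _ /=.
by rewrite mxE linearZl_LR linearZr_LR /= scalerA.
Qed.

Lemma tens_expand U V (t : U ⊗ V) : t = tlift (@tens K U V) t.
Proof.
apply/matrixP=> i j; rewrite /tlift summxE (bigD1 i) //= summxE (bigD1 j) //=.
have fr W (k l : 'I_(\dim {:W})) :
    coord (vbasis {:W}) k (vbasis {:W})`_l = (l == k)%:R.
  by rewrite coord_free // (basis_free (vbasisP _)).
rewrite !mxE !fr !eqxx !mulr1 big1 ?addr0 => [|l /negPf Hl]; last first.
  by rewrite !mxE !fr Hl !mulr0.
rewrite big1 ?addr0 // => k /negPf Hk.
by rewrite summxE big1 // => l _; rewrite !mxE !fr Hk mul0r mulr0.
Qed.

Lemma tlift_unique U V W (b : U -> V -> W)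
    (f : {linear (U ⊗ V)%type -> W}) :
  (forall u v, f (u ⊗ v) = b u v) -> forall t, f t = tlift b t.
Proof.
move=> fE t; rewrite {1}(tens_expand t) linear_sum; apply: eq_bigr => i _.
by rewrite linear_sum; apply: eq_bigr => j _; rewrite linearZ /= fE.
Qed.

End TensorTheory.

Definition tmap (K : fieldType) (U V U' V' : vectType K)
    (f : {linear U -> U'}) (g : {linear V -> V'}) : U ⊗ V -> U' ⊗ V' :=
  tlift (fun u v => f u ⊗ g v).

(* The flip, written σ in the literature. *)
Definition tswap (K : fieldType) (U V : vectType K) : U ⊗ V -> V ⊗ U :=
  tlift (fun u v => v ⊗ u).

(* The canonical identification (U ⊗ V) ⊗ W = U ⊗ (V ⊗ W). *)
Definition tassoc (K : fieldType) (U V W : vectType K) :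
    (U ⊗ V) ⊗ W -> U ⊗ (V ⊗ W) :=
  tlift (fun t w => tlift (fun u v => u ⊗ (v ⊗ w)) t).

Section TensorMaps.
Variable K : fieldType.
Implicit Types U V W : vectType K.

HB.instance Definition _ U V U' V' (f : {linear U -> U'})
    (g : {linear V -> V'}) := GRing.Linear.on (tmap f g).
HB.instance Definition _ U V := GRing.Linear.on (@tswap K U V).
HB.instance Definition _ U V W := GRing.Linear.on (@tassoc K U V W).

Lemma tmapE U V U' V' (f : {linear U -> U'}) (g : {linear V -> V'}) u v :
  tmap f g (u ⊗ v) = f u ⊗ g v.
Proof.
apply: (tlift_tens (b := fun u v => f u ⊗ g v)).
by split=> [y|x] a z t; rewrite linearP ?linearPl ?linearPr.
Qed.

Lemma tswapE U V (u : U) (v : V) : tswap (u ⊗ v) = v ⊗ u.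
Proof.
apply: (tlift_tens (b := fun u v => v ⊗ u)).
by split=> [y|x] a z t; rewrite ?linearPl ?linearPr.
Qed.

Lemma tassocE U V W (u : U) (v : V) (w : W) :
  tassoc ((u ⊗ v) ⊗ w) = u ⊗ (v ⊗ w).
Proof.
rewrite /tassoc tlift_tens; last first.
  split=> [y|t] a x z; first by rewrite linearP.
  by apply: tlift_comb => u' v'; rewrite !linearPr.
rewrite (tlift_tens (b := fun u v => u ⊗ (v ⊗ w))) //.
by split=> [y|x] a z t; rewrite ?linearPl ?linearPr.
Qed.

End TensorMaps.

Section MulOperators.
Variables (K : fieldType) (A : vectType K).
Implicit Types m : {bilinear A -> A -> A}.

Definition Lop m (x : A) : A -> A := fun y => m x y.
Definition Rop m (y : A) : A -> A := fun x => m x y.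

Fact Lop_is_linear m x : linear (Lop m x).
Proof. by move=> a y z; rewrite /Lop linearPr. Qed.
Fact Rop_is_linear m y : linear (Rop m y).
Proof. by move=> a x z; rewrite /Rop linearPl. Qed.

HB.instance Definition _ m x :=
  GRing.isLinear.Build K A A _ (Lop m x) (Lop_is_linear m x).
HB.instance Definition _ m y :=
  GRing.isLinear.Build K A A _ (Rop m y) (Rop_is_linear m y).

End MulOperators.

(* In what follows dl and dr are the operations ⊣ and ⊢, dbullet is •, and
   Dl, Dr and cobullet are the cooperations Δ_⊣, Δ_⊢ and Δ_•. *)

Definition dbullet (K : fieldType) (A : vectType K)
    (dl dr : {bilinear A -> A -> A}) (x y : A) : A := dr x y - dl x y.

Definition cobullet (K : fieldType) (A : vectType K)
    (Dl Dr : {linear A -> (A ⊗ A)%type}) (x : A) : A ⊗ A := Dr x - Dl x.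

Fact dbullet_is_bilinear (K : fieldType) (A : vectType K)
    (dl dr : {bilinear A -> A -> A}) :
  bilinear_for *:%R *:%R (dbullet dl dr).
Proof.
split=> [y|x] a u v.
  rewrite /dbullet !linearPl opprD addrACA -[RHS]/(a *: (_ - _) + _).
  by rewrite scalerBr.
rewrite /dbullet !linearPr opprD addrACA -[RHS]/(a *: (_ - _) + _).
by rewrite scalerBr.
Qed.

HB.instance Definition _ (K : fieldType) (A : vectType K)
    (dl dr : {bilinear A -> A -> A}) :=
  bilinear_isBilinear.Build K A A A *:%R *:%R (dbullet dl dr)
    (dbullet_is_bilinear dl dr).

Fact cobullet_is_linear (K : fieldType) (A : vectType K)
    (Dl Dr : {linear A -> (A ⊗ A)%type}) : linear (cobullet Dl Dr).
Proof.
by move=> a x y; rewrite /cobullet !linearP addrACA -scalerDr.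
Qed.

HB.instance Definition _ (K : fieldType) (A : vectType K)
    (Dl Dr : {linear A -> (A ⊗ A)%type}) :=
  GRing.isLinear.Build K A (A ⊗ A)%type _ (cobullet Dl Dr)
    (cobullet_is_linear Dl Dr).

Record diassociative_algebra (K : fieldType) (A : vectType K)
    (dl dr : {bilinear A -> A -> A}) : Prop := DiassociativeAlgebra {
  dias_ll_l : forall x y z, dl (dl x y) z = dl x (dl y z);
  dias_l_lr : forall x y z, dl x (dl y z) = dl x (dr y z);
  dias_rl : forall x y z, dl (dr x y) z = dr x (dl y z);
  dias_rr_lr : forall x y z, dr (dr x y) z = dr (dl x y) z;
  dias_lr_r : forall x y z, dr (dl x y) z = dr x (dr y z)
}.

Record diassociative_coalgebra (K : fieldType) (A : vectType K)
    (Dl Dr : {linear A -> (A ⊗ A)%type}) : Prop := DiassociativeCoalgebra {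
  codias_l_lr : forall x, tmap idfun Dl (Dl x) = tmap idfun Dr (Dl x);
  codias_l_rl : forall x,
    tmap idfun Dr (Dl x) = tassoc (tmap Dl idfun (Dl x));
  codias_rl : forall x,
    tassoc (tmap Dr idfun (Dl x)) = tmap idfun Dl (Dr x);
  codias_lr_rr : forall x, tmap Dl idfun (Dr x) = tmap Dr idfun (Dr x);
  codias_rr_r : forall x,
    tassoc (tmap Dr idfun (Dr x)) = tmap idfun Dr (Dr x)
}.

Record diassociative_bialgebra (K : fieldType) (A : vectType K)
    (dl dr : {bilinear A -> A -> A}) (Dl Dr : {linear A -> (A ⊗ A)%type}) : Prop :=
  DiassociativeBialgebra {
  dibi_algebra : diassociative_algebra dl dr;
  dibi_coalgebra : diassociative_coalgebra Dl Dr;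
  dibi_1a : forall x y,
    Dr (dl x y) = tmap idfun (Lop dl x) (Dr y)
                  - tmap (Rop (dbullet dl dr) y) idfun (Dr x);
  dibi_1b : forall x y,
    tmap idfun (Lop dl x) (Dr y) - tmap (Rop (dbullet dl dr) y) idfun (Dr x)
    = tmap idfun (Lop dl x) (cobullet Dl Dr y) + tmap (Rop dl y) idfun (Dr x);
  dibi_2a : forall x y,
    tswap (tmap (Lop dr y) idfun (Dr x))
    - tmap (Lop dl x) idfun (cobullet Dl Dr y)
    = tmap (Lop dl x) idfun (Dl y)
      + tswap (tmap (Lop (dbullet dl dr) y) idfun (Dr x));
  dibi_2b : forall x y,
    tmap (Lop dl x) idfun (Dl y)
    + tswap (tmap (Lop (dbullet dl dr) y) idfun (Dr x))
    = tswap (tmap idfun (Rop dl y) (Dr x))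
      + tmap idfun (Rop (dbullet dl dr) x) (cobullet Dl Dr y);
  dibi_3a : forall x y,
    tswap (tmap idfun (Rop dr y) (Dr x))
    - tmap idfun (Rop (dbullet dl dr) x) (Dl y)
    = tmap idfun (Rop dl x) (Dl y)
      + tswap (tmap idfun (Rop dr y) (cobullet Dl Dr x));
  dibi_3b : forall x y,
    tmap idfun (Rop dl x) (Dl y)
    + tswap (tmap idfun (Rop dr y) (cobullet Dl Dr x))
    = tmap (Lop dr x) idfun (Dl y)
      + tswap (tmap (Lop (dbullet dl dr) y) idfun (cobullet Dl Dr x));
  dibi_4a : forall x y,
    Dl (dr x y) = tmap idfun (Lop dr x) (Dl y)
                  - tmap (Rop dr y) idfun (cobullet Dl Dr x);
  dibi_4b : forall x y,
    tmap idfun (Lop dr x) (Dl y) - tmap (Rop dr y) idfun (cobullet Dl Dr x)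
    = tmap idfun (Lop (dbullet dl dr) x) (Dl y) + tmap (Rop dr y) idfun (Dl x);
  dibi_5 : forall x y,
    Dl (dl x y) = tmap (Rop dl y) idfun (Dl x)
                  - tmap idfun (Lop (dbullet dl dr) x) (cobullet Dl Dr y);
  dibi_6 : forall x y,
    Dr (dr x y) = tmap idfun (Lop dr x) (Dr y)
                  - tmap (Rop (dbullet dl dr) y) idfun (cobullet Dl Dr x)
}.

(* D(r) for r = \sum_i u i ⊗ v i *)
Definition DYBE (K : fieldType) (A : vectType K)
    (dl dr : {bilinear A -> A -> A}) (n : nat) (u v : 'I_n -> A) :
    (A ⊗ A) ⊗ A :=
  \sum_i \sum_j (dr (u i) (u j) ⊗ v i ⊗ v j
                 - u i ⊗ u j ⊗ dl (v i) (v j)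
                 - u i ⊗ dbullet dl dr (u j) (v i) ⊗ v j).

Section Coboundary.
Variables (K : fieldType) (A : vectType K) (dl dr : {bilinear A -> A -> A}).
Variable r : A ⊗ A.

Definition coprod_l (x : A) : A ⊗ A :=
  tmap idfun (Lop (dbullet dl dr) x) r - tmap (Rop dr x) idfun r.

Definition coprod_r (x : A) : A ⊗ A :=
  tmap idfun (Lop dl x) (- r) + tmap (Rop (dbullet dl dr) x) idfun (- r).

Let tmapL_linear (m : {bilinear A -> A -> A}) (t : A ⊗ A) :
  linear (fun x => tmap idfun (Lop m x) t : A ⊗ A).
Proof.
move=> a x y; apply: tlift_comb => u v /=.
by rewrite /Lop ?linearPl ?linearPr ?linearPl.
Qed.

Let tmapR_linear (m : {bilinear A -> A -> A}) (t : A ⊗ A) :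
  linear (fun x => tmap (Rop m x) idfun t : A ⊗ A).
Proof.
move=> a x y; apply: tlift_comb => u v /=.
by rewrite /Rop ?linearPl ?linearPr ?linearPl.
Qed.

Fact coprod_l_is_linear : linear coprod_l.
Proof.
move=> a x y.
by rewrite /coprod_l tmapL_linear tmapR_linear scalerBr opprD addrACA.
Qed.

Fact coprod_r_is_linear : linear coprod_r.
Proof.
by move=> a x y; rewrite /coprod_r tmapL_linear tmapR_linear scalerDr addrACA.
Qed.

HB.instance Definition _ :=
  GRing.isLinear.Build K A (A ⊗ A)%type _ coprod_l coprod_l_is_linear.
HB.instance Definition _ :=
  GRing.isLinear.Build K A (A ⊗ A)%type _ coprod_r coprod_r_is_linear.

End Coboundary.

(* Main.v *)
Require Import Defs.
From mathcomp Require Import all_boot all_order all_algebra.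
From mathcomp Require Import ring.

Set Implicit Arguments.
Unset Strict Implicit.
Unset Printing Implicit Defensive.

Import GRing.Theory.
Local Open Scope ring_scope.

(* Both cooperations have the form x |-> \sum_i (u_i ⊗ p(x, v_i) - q(u_i, x) ⊗ v_i)
   with (p, q) = (•, ⊢) for Δ_⊣ and (p, q) = (-⊣, •) for Δ_⊢.  The
   compatibility conditions are linear in r and hold summand by summand, up to
   exchanging u_i and v_i where σ occurs.  The coalgebra identities are quadratic
   in r.  For a trilinear T and an operation m put
     X_m = \sum T(u_i m u_j, v_i, v_j),  Y_m = \sum T(u_i, u_j m v_i, v_j),
     Z_m = \sum T(u_i, u_j, v_i m v_j).
   The DYBE says X_⊢ = Y_• + Z_⊣, and since r is symmetric the cyclic rotations
   of this equation hold too.  Each coalgebra identity is a combination of these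
   three relations, with T composed with multiplication by x in an outer slot. *)

(** * Calculus of maps induced on tensors *)

Section Tensors.
Variable K : fieldType.
Implicit Types U V W : vectType K.

Lemma eq_tlift U V W (b b' : U -> V -> W) t :
  (forall u v, b u v = b' u v) -> tlift b t = tlift b' t.
Proof.
by move=> bE; apply: eq_bigr => i _; apply: eq_bigr => j _; rewrite bE.
Qed.

Lemma tliftD U V W (b b' : U -> V -> W) t :
  tlift b t + tlift b' t = tlift (fun u v => b u v + b' u v) t.
Proof.
symmetry; rewrite (tlift_comb (a := 1) (b1 := b) (b2 := b')) ?scale1r //.
by move=> u v; rewrite scale1r.
Qed.

Lemma linear_tlift U V W W' (f : {linear W -> W'}) (b : U -> V -> W) t :
  f (tlift b t) = tlift (fun u v => f (b u v)) t.
Proof.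
rewrite linear_sum; apply: eq_bigr => i _; rewrite linear_sum.
by apply: eq_bigr => j _; rewrite linearZ.
Qed.

Lemma tliftN U V W (b : U -> V -> W) t :
  - tlift b t = tlift (fun u v => - b u v) t.
Proof. exact: (linear_tlift (-%R : {linear W -> W})). Qed.

(** Both sides are the same finite sum over four basis indices. This serves to exchange the two
    copies of $r$. *)
Lemma exchange_tlift U V U' V' W (F : U -> V -> U' -> V' -> W) s t :
  tlift (fun a b => tlift (F a b) t) s
  = tlift (fun c d => tlift (fun a b => F a b c d) s) t.
Proof.
rewrite /tlift.
under eq_bigr do under eq_bigr do
  (rewrite scaler_sumr; under eq_bigr do rewrite scaler_sumr).
under [RHS]eq_bigr do under eq_bigr do
  (rewrite scaler_sumr; under eq_bigr do rewrite scaler_sumr).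
under eq_bigr do (rewrite exchange_big; under eq_bigr do rewrite exchange_big).
rewrite exchange_big; apply: eq_bigr => k _ /=.
rewrite exchange_big; apply: eq_bigr => l _ /=.
apply: eq_bigr => i _; apply: eq_bigr => j _.
by rewrite !scalerA mulrC.
Qed.

Lemma trmx_tswap U V (t : U ⊗ V) : (t^T : V ⊗ U) = tswap t.
Proof.
apply: (tlift_unique (f := trmx : {linear (U ⊗ V)%type -> (V ⊗ U)%type})).
by move=> u v; apply/matrixP=> i j; rewrite !mxE mulrC.
Qed.

Lemma tlift_tswap U V W (b : V -> U -> W) t :
  tlift b (tswap t) = tlift (fun u v => b v u) t.
Proof.
rewrite -trmx_tswap /tlift exchange_big; apply: eq_bigr => i _.
by apply: eq_bigr => j _; rewrite mxE.
Qed.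

(** Passes from a given decomposition of $r$ to its expansion in basis tensors, over which [tlift]
    sums. *)
Lemma sum_tlift U V W (b : U -> V -> W) n (u : 'I_n -> U) (v : 'I_n -> V) :
  bilinear_for *:%R *:%R b ->
  \sum_i b (u i) (v i) = tlift b (\sum_i u i ⊗ v i).
Proof.
by move=> bP; rewrite linear_sum; apply: eq_bigr => i _; rewrite /= tlift_tens.
Qed.

Lemma tmap_tlift U V U1 V1 U2 V2 (f : {linear U1 -> U2}) (g : {linear V1 -> V2})
    (b : U -> V -> U1 ⊗ V1) t :
  tmap f g (tlift b t) = tlift (fun u v => tmap f g (b u v)) t.
Proof. exact: linear_tlift. Qed.

Lemma tswap_tmap U1 V1 U2 V2 (f : {linear U1 -> U2}) (g : {linear V1 -> V2}) t :
  tswap (tmap f g t) = tmap g f (tswap t).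
Proof.
rewrite [in LHS]/tmap linear_tlift /tswap tmap_tlift; apply: eq_tlift => u v.
by rewrite /= -/(tswap _) tswapE tmapE.
Qed.

Lemma tens_tliftr U V U1 V1 (w : U) (b : U1 -> V1 -> V) t :
  w ⊗ tlift b t = tlift (fun u v => w ⊗ b u v) t.
Proof.
rewrite linear_sumr; apply: eq_bigr => i _; rewrite linear_sumr.
by apply: eq_bigr => j _; rewrite linearZr_LR.
Qed.

Lemma tens_tliftl U V U1 V1 (w : V) (b : U1 -> V1 -> U) t :
  tlift b t ⊗ w = tlift (fun u v => b u v ⊗ w) t.
Proof.
rewrite linear_sumlz; apply: eq_bigr => i _; rewrite linear_sumlz.
by apply: eq_bigr => j _; rewrite linearZl_LR.
Qed.

Lemma tmapB U1 V1 U2 V2 (f : {linear U1 -> U2}) (g : {linear V1 -> V2}) s t :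
  tmap f g (s - t) = tmap f g s - tmap f g t.
Proof. exact: linearB. Qed.

Lemma tswapB U V (s t : U ⊗ V) : tswap (s - t) = tswap s - tswap t.
Proof. exact: linearB. Qed.

Lemma tmapN U1 V1 U2 V2 (f : {linear U1 -> U2}) (g : {linear V1 -> V2}) t :
  tmap f g (- t) = - tmap f g t.
Proof. exact: linearN. Qed.

Lemma tswapN U V (t : U ⊗ V) : tswap (- t) = - tswap t.
Proof. exact: linearN. Qed.

Lemma tensBl U V (u u' : U) (v : V) : (u - u') ⊗ v = u ⊗ v - u' ⊗ v.
Proof. exact: linearBl. Qed.

Lemma tensBr U V (u : U) (v v' : V) : u ⊗ (v - v') = u ⊗ v - u ⊗ v'.
Proof. exact: linearBr. Qed.

Lemma tensNr U V (u : U) (v : V) : u ⊗ (- v) = - (u ⊗ v).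
Proof. exact: linearNr. Qed.

Lemma tensNl U V (u : U) (v : V) : (- u) ⊗ v = - (u ⊗ v).
Proof. exact: linearNl. Qed.

End Tensors.

(** * Trilinear maps and the triple tensor product *)

Section Trilinear.
Variables (K : fieldType) (A W : vectType K).
Implicit Types T : A -> A -> A -> W.

Definition trilinear T := [/\ forall y z, linear (fun x => T x y z),
  forall x z, linear (fun y => T x y z) & forall x y, linear (T x y)].

Lemma trilinear_rot T : trilinear T -> trilinear (fun x y z => T z x y).
Proof. by case. Qed.

(** The existence half of the universal property of $A\otimes A\otimes A$, obtained by lifting the
    first two slots and then the third. *)
Lemma trilinear_lift T : trilinear T ->
  exists f : {linear ((A ⊗ A) ⊗ A)%type -> W},
    forall x y z, f (x ⊗ y ⊗ z) = T x y z.
Proof.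
case=> T1 T2 T3; exists (tlift (fun t z => tlift (fun x y => T x y z) t)).
move=> x y z /=; rewrite tlift_tens; last first.
  split=> [z'|t] a s s'; first by rewrite linearP.
  by apply: tlift_comb => x' y'; rewrite T3.
by rewrite (tlift_tens (b := fun x y => T x y z)).
Qed.

End Trilinear.

(** Test maps for the coalgebra identities: one of [f], [g] will be the identity, the other a
    multiplication by $x$. *)
Lemma trilinear_tensr (K : fieldType) (A : vectType K) (f g : {linear A -> A}) :
  trilinear (fun x y z => f x ⊗ (y ⊗ g z)).
Proof. by split=> ? ? k s t; rewrite ?linearP !(linearPl, linearPr). Qed.

Lemma trilinear_tensl (K : fieldType) (A : vectType K) (f g : {linear A -> A}) :
  trilinear (fun x y z => f x ⊗ y ⊗ g z).
Proof. by split=> ? ? k s t; rewrite ?linearP !(linearPl, linearPr). Qed.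

(* Identities between integral combinations of tensors are read off entrywise,
   as identities in K. *)
Ltac tensor_ring := apply/matrixP => ? ?; rewrite !mxE; ring.

(** * The DYBE and its rotations, tested against trilinear maps *)

Section YangBaxter.
Variables (K : fieldType) (A W : vectType K) (dl dr : {bilinear A -> A -> A}).
Variables (n : nat) (u v : 'I_n -> A) (r : A ⊗ A).
Hypotheses (r_def : r = \sum_i u i ⊗ v i) (r_sym : tswap r = r).
Hypothesis r_sol : DYBE dl dr u v = 0.
Implicit Types T : A -> A -> A -> W.

(** The summand of $D(r)$ is bilinear in each copy of $r$, so the decomposition $u_i\otimes v_i$ may
    be traded for the basis expansion. *)
Lemma DYBE_tlift :
  tlift (fun a b => tlift (fun c d => dr a c ⊗ b ⊗ d - a ⊗ c ⊗ dl b d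
     - a ⊗ dbullet dl dr c b ⊗ d) r) r = 0.
Proof.
pose F a b c d : (A ⊗ A) ⊗ A := dr a c ⊗ b ⊗ d - a ⊗ c ⊗ dl b d
  - a ⊗ dbullet dl dr c b ⊗ d.
rewrite -[LHS]/(tlift (fun a b => tlift (F a b) r) r).
have F_cd a b : bilinear_for *:%R *:%R (F a b).
  by split=> [d|c] k s t; rewrite /F !(linearPl, linearPr) /=; tensor_ring.
have F_ab c d : bilinear_for *:%R *:%R (fun a b => F a b c d).
  by split=> [b|a] k s t; rewrite /F !(linearPl, linearPr) /=; tensor_ring.
rewrite -[RHS]r_sol /DYBE [in LHS]r_def.
rewrite -(sum_tlift (b := fun a b => tlift (F a b) _)).
  by apply: eq_bigr => i _; rewrite -sum_tlift.
split=> [b|a] k s t; apply: tlift_comb => c d; have [F1 F2] := F_ab c d.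
  by rewrite F1.
by rewrite F2.
Qed.

Lemma tlift_sym (b : A -> A -> W) : tlift b r = tlift (fun x y => b y x) r.
Proof. by rewrite -[in LHS]r_sym tlift_tswap. Qed.

Local Notation X m T :=
  (tlift (fun a b => tlift (fun c d => T (m a c) b d) r) r).
Local Notation Y m T :=
  (tlift (fun a b => tlift (fun c d => T a (m c b) d) r) r).
Local Notation Z m T :=
  (tlift (fun a b => tlift (fun c d => T a c (m b d)) r) r).

(** [T] factors through $A\otimes A\otimes A$, where the DYBE is an equation. *)
Lemma DYBE0 T : trilinear T -> X dr T - Z dl T - Y dr T + Y dl T = 0.
Proof.
case/trilinear_lift=> f fE; rewrite !(tliftN, tliftD).
rewrite -[RHS](linear0 f) -DYBE_tlift linear_tlift; apply: eq_tlift => a b.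
rewrite !(tliftN, tliftD) linear_tlift; apply: eq_tlift => c d.
by rewrite /dbullet tensBr tensBl !linearB /= !fE opprK addrA.
Qed.

(** Rotating the slots of [T] permutes the three sums cyclically. Exchanging the copies of $r$ and
    flipping one of them realises this for [XY] and [YZ], flipping both for [ZX]. *)
Let XY m T : X m (fun x y z => T z x y) = Y m T.
Proof. by rewrite exchange_tlift tlift_sym. Qed.

Let YZ m T : Y m (fun x y z => T z x y) = Z m T.
Proof. by rewrite exchange_tlift tlift_sym. Qed.

Let ZX m T : Z m (fun x y z => T z x y) = X m T.
Proof. by rewrite tlift_sym; apply: eq_tlift => a b; rewrite tlift_sym. Qed.

Lemma DYBE1 T : trilinear T -> Y dr T - X dl T - Z dr T + Z dl T = 0.
Proof.
move=> T_lin; rewrite -(DYBE0 (trilinear_rot T_lin)).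
by rewrite !(XY _ T, YZ _ T, ZX _ T).
Qed.

Lemma DYBE2 T : trilinear T -> Z dr T - Y dl T - X dr T + X dl T = 0.
Proof.
move=> T_lin; rewrite -(DYBE1 (trilinear_rot T_lin)).
by rewrite !(XY _ T, YZ _ T, ZX _ T).
Qed.

End YangBaxter.

(** * Iterated coproducts written with two copies of $r$ *)

Section Coassociativity.
Variables (K : fieldType) (A : vectType K) (r : A ⊗ A).
Variables (D D' : {linear A -> (A ⊗ A)%type}) (p q p' q' : A -> A -> A).
Hypothesis DE : forall x, D x = tlift (fun u v => u ⊗ p x v - q u x ⊗ v) r.
Hypothesis D'E : forall x, D' x = tlift (fun u v => u ⊗ p' x v - q' u x ⊗ v) r.

Lemma tmap_id_coprod x :
  tmap idfun D' (D x) = tlift (fun a b => tlift (fun c d =>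
    a ⊗ (c ⊗ p' (p x b) d - q' c (p x b) ⊗ d)
    - q a x ⊗ (c ⊗ p' b d - q' c b ⊗ d)) r) r.
Proof.
rewrite DE tmap_tlift; apply: eq_tlift => a b.
by rewrite tmapB !tmapE !D'E /= !tens_tliftr tliftN tliftD.
Qed.

(* The two copies of r are exchanged so that the factors of each copy sit in
   the same slots as in the relations DYBE0, DYBE1 and DYBE2. *)
Lemma tmap_coprod_id x :
  tmap D' idfun (D x) = tlift (fun a b => tlift (fun c d =>
    (a ⊗ p' c b - q' a c ⊗ b) ⊗ p x d
    - (a ⊗ p' (q c x) b - q' a (q c x) ⊗ b) ⊗ d) r) r.
Proof.
rewrite DE tmap_tlift exchange_tlift; apply: eq_tlift => a b.
by rewrite tmapB !tmapE !D'E /= !tens_tliftl tliftN tliftD.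
Qed.

Lemma tassoc_tmap_coprod_id x :
  tassoc (tmap D' idfun (D x)) = tlift (fun a b => tlift (fun c d =>
    (a ⊗ (p' c b ⊗ p x d) - q' a c ⊗ (b ⊗ p x d))
    - (a ⊗ (p' (q c x) b ⊗ d) - q' a (q c x) ⊗ (b ⊗ d))) r) r.
Proof.
rewrite tmap_coprod_id !linear_tlift; apply: eq_tlift => a b /=.
rewrite linear_tlift; apply: eq_tlift => c d /=.
by rewrite !tensBl !linearB /= !tassocE.
Qed.

End Coassociativity.

(** * The coproducts defined by $r$ *)

Section Coboundary.
Variables (K : fieldType) (A : vectType K) (dl dr : {bilinear A -> A -> A}).
Hypothesis dias : diassociative_algebra dl dr.

(** The axioms oriented as rewrite rules. Every product of three factors reaches one of the normal
    forms $x\dashv(y\dashv z)$, $x\vdash(y\dashv z)$, $x\vdash(y\vdash z)$. *)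
Let dias_norm := (dias_ll_l dias, =^~ dias_l_lr dias, dias_rl dias,
  dias_rr_lr dias, dias_lr_r dias).

Let dlBl x x' y : dl (x - x') y = dl x y - dl x' y. Proof. exact: linearBl. Qed.
Let dlBr x y y' : dl x (y - y') = dl x y - dl x y'. Proof. exact: linearBr. Qed.
Let drBl x x' y : dr (x - x') y = dr x y - dr x' y. Proof. exact: linearBl. Qed.
Let drBr x y y' : dr x (y - y') = dr x y - dr x y'. Proof. exact: linearBr. Qed.
Let dlNl x y : dl (- x) y = - dl x y. Proof. exact: linearNl. Qed.
Let dlNr x y : dl x (- y) = - dl x y. Proof. exact: linearNr. Qed.
Let drNl x y : dr (- x) y = - dr x y. Proof. exact: linearNl. Qed.
Let drNr x y : dr x (- y) = - dr x y. Proof. exact: linearNr. Qed.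

Let linE := (dlBl, dlBr, drBl, drBr, dlNl, dlNr, drNl, drNr).

Variables (r : A ⊗ A) (r_sym : tswap r = r).
Local Notation Dl := (coprod_l dl dr r).
Local Notation Dr := (coprod_r dl dr r).

Lemma coprod_lE x :
  Dl x = tlift (fun u v => u ⊗ dbullet dl dr x v - dr u x ⊗ v) r.
Proof. by rewrite /coprod_l tliftN tliftD. Qed.

Lemma coprod_rE x :
  Dr x = tlift (fun u v => u ⊗ (- dl x v) - dbullet dl dr u x ⊗ v) r.
Proof.
rewrite /coprod_r !linearN /= !tliftN tliftD; apply: eq_tlift => u v.
by rewrite tensNr.
Qed.

(** The operation $\bullet$ disappears, since $-\dashv-\bullet=-\vdash$ in the right factor and
    $\vdash-\bullet=\dashv$ in the left one. *)
Lemma cobulletE x :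
  cobullet Dl Dr x = tlift (fun u v => dl u x ⊗ v - u ⊗ dr x v) r.
Proof.
rewrite /cobullet /= coprod_lE coprod_rE tliftN tliftD.
apply: eq_tlift => u v; rewrite /dbullet tensNr tensBl tensBr; tensor_ring.
Qed.

(** The flip puts $v_i$ to the left of $u_i$, and the symmetry of $r$ renames them back. Terms under
    $\sigma$ thus become comparable with the others summand by summand. *)
Lemma tswap_tmap_tlift (f g : {linear A -> A}) (b : A -> A -> A ⊗ A) :
  tswap (tmap f g (tlift b r)) = tlift (fun u v => tmap g f (tswap (b v u))) r.
Proof.
rewrite tmap_tlift linear_tlift -[in LHS]r_sym tlift_tswap.
by apply: eq_tlift => u v; rewrite /= tswap_tmap.
Qed.

Ltac expand_words :=
  rewrite /= /Lop /Rop /dbullet ?(tensBl, tensBr, tensNl, tensNr, linE)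
    ?dias_norm.

Ltac summandwise :=
  rewrite /= ?(coprod_lE, coprod_rE, cobulletE)
    ?(tswap_tmap_tlift, tmap_tlift) ?(tliftN, tliftD);
  apply: eq_tlift => ? ?;
  rewrite /dbullet ?(tensBl, tensBr, tensNl, tensNr);
  rewrite ?(tswapB, tswapN, tmapB, tmapN, tswapE, tmapE);
  expand_words; tensor_ring.

(** For identities quadratic in $r$: once the relevant relations are added, both sides agree for
    each pair of summands of the two copies. *)
Ltac summandwise2 :=
  rewrite ?(tliftN, tliftD); apply: eq_tlift => ? ?;
  rewrite ?(tliftN, tliftD); apply: eq_tlift => ? ?;
  expand_words; tensor_ring.

(** * The coalgebra axioms and the compatibility conditions *)

Variables (n : nat) (u v : 'I_n -> A).
Hypotheses (r_def : r = \sum_i u i ⊗ v i) (r_sol : DYBE dl dr u v = 0).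

Lemma coprod_coalgebra : diassociative_coalgebra Dl Dr.
Proof.
split=> x.
- rewrite (tmap_id_coprod coprod_lE coprod_lE).
  rewrite (tmap_id_coprod coprod_lE coprod_rE) -[LHS]addr0.
  (* As $(a\bullet c)\vdash x=0$, the X terms cancel. What remains, $Z_\vdash=Y_\dashv$, is the
     discrepancy between the two sides. *)
  rewrite -(DYBE2 r_def r_sym r_sol (trilinear_tensr (Rop dr x) idfun)).
  summandwise2.
- rewrite (tmap_id_coprod coprod_lE coprod_rE).
  rewrite (tassoc_tmap_coprod_id coprod_lE coprod_lE) -[LHS]subr0.
  (* Terms with $x$ in the middle slot agree by the axioms. The others need the DYBE with
     $x\,\bullet$ applied in the last slot and, below, $\vdash x$ in the first. *)
  rewrite -(DYBE0 r_def r_sol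
              (trilinear_tensr idfun (Lop (dbullet dl dr) x))).
  rewrite -[LHS]addr0.
  rewrite -(DYBE0 r_def r_sol (trilinear_tensr (Rop dr x) idfun)).
  summandwise2.
- rewrite (tmap_id_coprod coprod_rE coprod_lE).
  rewrite (tassoc_tmap_coprod_id coprod_lE coprod_rE) -[LHS]subr0.
  (* The inner coproduct selects the rotation: $\Delta_\vdash$ on the left factor gives $Y_\dashv$
     and $X_\bullet$, as in [DYBE2]; $\Delta_\dashv$ on the right factor gives $Y_\vdash$ and
     $Z_\bullet$, as in [DYBE1]. *)
  rewrite -(DYBE2 r_def r_sym r_sol
              (trilinear_tensr idfun (Lop (dbullet dl dr) x))).
  rewrite -[LHS]addr0.
  rewrite -(DYBE1 r_def r_sym r_sol
              (trilinear_tensr (Rop (dbullet dl dr) x) idfun)).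
  summandwise2.
- rewrite (tmap_coprod_id coprod_rE coprod_lE).
  rewrite (tmap_coprod_id coprod_rE coprod_rE) -[LHS]addr0.
  (* Mirror image of the first identity: $x\dashv(b\bullet d)=0$ cancels the Z terms and leaves
     $Y_\vdash=X_\dashv$. *)
  rewrite -(DYBE1 r_def r_sym r_sol (trilinear_tensl idfun (Lop dl x))).
  summandwise2.
- rewrite (tmap_id_coprod coprod_rE coprod_rE).
  rewrite (tassoc_tmap_coprod_id coprod_rE coprod_rE) -[LHS]addr0.
  (* [DYBE2] answers to $\Delta_\vdash$ on the left factor, and [DYBE0] below to $\Delta_\vdash$ on
     the right one, which gives $Z_\dashv$ and $Y_\bullet$. *)
  rewrite -(DYBE2 r_def r_sym r_sol (trilinear_tensr idfun (Lop dl x))).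
  rewrite -[LHS]subr0.
  rewrite -(DYBE0 r_def r_sol
              (trilinear_tensr (Rop (dbullet dl dr) x) idfun)).
  summandwise2.
Qed.

Lemma coprod_bialgebra : diassociative_bialgebra dl dr Dl Dr.
Proof.
split=> [//||x y|x y|x y|x y|x y|x y|x y|x y|x y|x y].
  exact: coprod_coalgebra.
all: summandwise.
Qed.

End Coboundary.

Theorem proposition4p2 (K : fieldType) (charK0 : [pchar K] =i pred0)
    (A : vectType K) (dl dr : {bilinear A -> A -> A})
    (dias : diassociative_algebra dl dr)
    (n : nat) (u v : 'I_n -> A) (r : A ⊗ A)
    (r_def : r = \sum_i u i ⊗ v i)
    (r_sym : tswap r = r)
    (r_sol : DYBE dl dr u v = 0) :
  diassociative_bialgebra dl dr (coprod_l dl dr r) (coprod_r dl dr r).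
Proof. exact: coprod_bialgebra r_def r_sol. Qed.
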